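(* Let $X=[0,1]^{\mathbb N_0}$ with shift $\sigma$, let $h\in C^2([0,1]^2;\mathbb R)$ satisfy $D_2D_1h<0$ on $[0,1]^2$, and $\varphi(\underline{x})=h(x_0,x_1)$. Then the Mañé set is \[N_\varphi=\{\underline{x}\in X: \sigma^i(\underline{x})\neq\sigma^j(\underline{x})\text{ whenever } i\neq j\}\ \cup\ \bigcup_{M\in\mathbb N_0}\sigma^{-M}\big(\{a^\infty: a\in\mathrm{m}_h\}\big).\]
   Context: $X=[0,1]^{\mathbb N_0}$ carries the metric $d_X(\underline{x},\underline{y})=\sum_{i\ge0}|x_i-y_i|/2^{i+1}$, and $\sigma(\underline{x})_i=x_{i+1}$. For Lipschitz $\varphi$, $\alpha_\varphi=\inf_\mu\int\varphi\,d\mu$ over $\sigma$-invariant Borel probability measures. $B(\underline{x},\underline{y},n;\varepsilon)=\{\underline{z}: d_X(\underline{x},\underline{z})<\varepsilon,\ d_X(\sigma^n\underline{z},\underline{y})<\varepsilon\}$, and the Mañé potential is $S_\varphi(\underline{x},\underline{y})=\lim_{\varepsilon\to0}\inf\{\sum_{i=0}^{n-1}(\varphi(\sigma^i\underline{z})-\alpha_\varphi): n\in\mathbb N,\ \underline{z}\in B(\underline{x},\underline{y},n;\varepsilon)\}$. A positive orbit $\{\sigma^n\underline{x}\}_{n\ge0}$ is $\varphi$-semi-static if $\sum_{n=i}^{j-1}(\varphi(\sigma^n\underline{x})-\alpha_\varphi)=S_\varphi(\sigma^i\underline{x},\sigma^j\underline{x})$ for all integers $0\le i<j$. The Mañé set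 is $N_\varphi=\{\sigma^k(\underline{x}): k\in\mathbb N_0,\ \{\sigma^n\underline{x}\}_{n\ge0}\text{ is }\varphi\text{-semi-static}\}$. $h^*=\min_x h(x,x)$, $\mathrm{m}_h=\{a:h(a,a)=h^*\}$, $a^\infty=aaa\ldots$. *)

(* Defs.v *)
From HB Require Import structures.
From mathcomp Require Import all_boot all_order all_algebra.
From mathcomp Require Import all_classical all_reals all_analysis.
Set Implicit Arguments. Unset Strict Implicit. Unset Printing Implicit Defensive.
Import Order.TTheory GRing.Theory Num.Theory.
Import numFieldNormedType.Exports.
Local Open Scope classical_set_scope.
Local Open Scope ring_scope.

Section Defs.
Variable R : realType.

Definition I01 : set R := [set t | 0 <= t <= 1].
Definition Sq01 : set (R * R) := [set p | 0 <= p.1 <= 1 /\ 0 <= p.2 <= 1].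

(** ** Differentiability on the closed square (one-sided at the boundary). *)

Definition is_partial1 (f d : R -> R -> R) : Prop :=
  forall x y, I01 x -> I01 y ->
    (fun t => (f t y - f x y) / (t - x)) @ within I01 (x^') --> d x y.

Definition is_partial2 (f d : R -> R -> R) : Prop :=
  forall x y, I01 x -> I01 y ->
    (fun t => (f x t - f x y) / (t - y)) @ within I01 (y^') --> d x y.

Definition cont_on_square (f : R -> R -> R) : Prop :=
  {within Sq01, continuous (fun p : R * R => f p.1 p.2)}.

(** [h] is C^2 on [0,1]^2 with partial derivatives D_1 h = d1, D_2 h = d2,
    D_1 D_1 h = d11, D_2 D_1 h = d21, D_1 D_2 h = d12, D_2 D_2 h = d22
    (D_j D_i h = derivative in variable j of D_i h), all continuous. *)
Definition is_C2_square (h d1 d2 d11 d21 d12 d22 : R -> R -> R) : Prop :=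
  is_partial1 h d1 /\ is_partial2 h d2 /\
  is_partial1 d1 d11 /\ is_partial2 d1 d21 /\
  is_partial1 d2 d12 /\ is_partial2 d2 d22 /\
  cont_on_square h /\ cont_on_square d1 /\ cont_on_square d2 /\
  cont_on_square d11 /\ cont_on_square d21 /\ cont_on_square d12 /\
  cont_on_square d22.

Record Xseq := MkX { xs :> nat -> R ; xs_in01 : forall i, 0 <= xs i <= 1 }.

HB.instance Definition _ := gen_eqMixin Xseq.
HB.instance Definition _ := gen_choiceMixin Xseq.

Lemma zero_in01 (i : nat) : 0 <= (fun _ : nat => (0 : R)) i <= 1.
Proof. by rewrite lexx ler01. Qed.

HB.instance Definition _ := isPointed.Build Xseq (MkX zero_in01).

Lemma shift_in01 (x : Xseq) i : 0 <= x i.+1 <= 1.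
Proof. exact: xs_in01. Qed.
Definition shift (x : Xseq) : Xseq := MkX (shift_in01 x).

Definition dX (x y : Xseq) : R :=
  limn (fun n => \sum_(0 <= i < n) (`|x i - y i| / 2 ^+ i.+1)).

Definition openX : set (set Xseq) :=
  [set A | forall x, A x -> exists2 e : R, 0 < e & forall y, dX x y < e -> A y].

Definition XB := g_sigma_algebraType openX.

Definition invariant_prob (mu : probability XB R) : Prop :=
  forall A : set XB, measurable A -> mu ((shift : XB -> XB) @^-1` A) = mu A.

Definition alpha (phi : Xseq -> R) : R :=
  fine (ereal_inf [set (\int[mu]_x (phi x)%:E)%E | mu in invariant_prob]).

Definition Bset (x y : Xseq) (n : nat) (eps : R) : set Xseq :=
  [set z | dX x z < eps /\ dX (iter n shift z) y < eps].

Definition bsum (phi : Xseq -> R) (z : Xseq) (m n : nat) : R :=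
  \sum_(m <= i < n) (phi (iter i shift z) - alpha phi).

Definition mane_inf (phi : Xseq -> R) (x y : Xseq) (eps : R) : \bar R :=
  ereal_inf [set r | exists n z, (0 < n)%N /\ Bset x y n eps z /\
                                  r = (bsum phi z 0 n)%:E].

Definition mane_pot (phi : Xseq -> R) (x y : Xseq) : \bar R :=
  lim ((mane_inf phi x y) @ (0 : R)^'+).

Definition semi_static (phi : Xseq -> R) (x : Xseq) : Prop :=
  forall i j : nat, (i < j)%N ->
    (bsum phi x i j)%:E = mane_pot phi (iter i shift x) (iter j shift x).

Definition mane_set (phi : Xseq -> R) : set Xseq :=
  [set y | exists k x, semi_static phi x /\ y = iter k shift x].

Definition phi_of (h : R -> R -> R) (x : Xseq) : R := h (x 0%N) (x 1%N).

Definition hstar (h : R -> R -> R) : R := inf [set h t t | t in I01].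
Definition mh (h : R -> R -> R) : set R := [set a | I01 a /\ h a a = hstar h].

Definition aperiodic_pts : set Xseq :=
  [set x | forall i j : nat, i != j -> iter i shift x != iter j shift x].

Definition preimages_fixed (h : R -> R -> R) : set Xseq :=
  [set x | exists (M : nat) (a : R), mh h a /\
                                     forall i, iter M shift x i = a].

End Defs.

(* Main.v *)
(** Let [v] be an antiderivative of [t |-> D_1 h(t, t)]. Since [D_1 h(t, .)] is
    strictly decreasing, [h x y - h y y >= v x - v y], strictly for [x <> y].
    Telescoping, every orbit segment satisfies
      [sum_(m <= i < n) (h(z_i, z_(i+1)) - h^* ) >= v(z_m) - v(z_n)],
    and a closed segment has cost [0] only if it is constant with value in [m_h].
    Integrating against an invariant measure gives [alpha = h^*].
    If [z] starts near [x] and [sigma^n z] is near [sigma^j x], then for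
    [n >= j] the segment from [j] to [n] is almost a loop and costs at least
    nearly [0], while a bounded [n < j] forces [sigma^n x = sigma^j x] in the
    limit. So an orbit is semi-static as soon as its closed segments have cost
    [0]; conversely, on a periodic semi-static orbit one and two periods have
    the same cost, which is therefore [0]. *)

Require Import Defs.
From HB Require Import structures.
From mathcomp Require Import all_boot all_order all_algebra.
From mathcomp Require Import all_classical all_reals all_analysis.
From mathcomp Require Import lra zify.
Import Order.TTheory GRing.Theory Num.Theory.
Import numFieldNormedType.Exports.
Local Open Scope classical_set_scope.
Local Open Scope ring_scope.
Set Implicit Arguments.
Unset Strict Implicit.
Unset Printing Implicit Defensive.

(** * Calculus on the closed unit interval and square *)

Section Calculus.
Variable R : realType.

Lemma I01E : @I01 R = `[0, 1]%classic.
Proof. by apply/seteqP; split=> t /=; rewrite in_itv. Qed.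

Lemma Sq01E : @Sq01 R = @I01 R `*` @I01 R.
Proof. by apply/seteqP; split=> -[a b]. Qed.

(** Relative continuity suffices because [(u t, v t)] never leaves the square, so the pair converges
    along the filter within [Sq01]. *)
Lemma cont_on_square_cvg (f : R -> R -> R) (T : Type) (F : set_system T)
    (FF : Filter F) (u v : T -> R) (a b : R) :
  cont_on_square f -> I01 a -> I01 b ->
  (forall t, I01 (u t)) -> (forall t, I01 (v t)) ->
  u @ F --> a -> v @ F --> b -> (fun t => f (u t) (v t)) @ F --> f a b.
Proof.
move=> /subspace_continuousP cf Ia Ib Iu Iv ua vb.
have cab := cf (a, b) (conj Ia Ib).
have cuv : (fun t => (u t, v t)) @ F --> within (@Sq01 R) (nbhs (a, b)).
  move=> A /= wA.
  have H := @cvg_pair _ _ _ _ _ _ FF (nbhs_filter a) (nbhs_filter b) _ _ ua vb.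
  have wA' : nbhs (a, b) [set p | Sq01 p -> A p] by exact: wA.
  have K : F [set t | Sq01 (u t, v t) -> A (u t, v t)] := H _ wA'.
  change (F [set t | A (u t, v t)]); apply: filterS K => t /=; apply.
  exact: (conj (Iu t) (Iv t)).
exact: (@cvg_comp _ _ _ (fun t => (u t, v t)) (fun p => f p.1 p.2) F
  (within (@Sq01 R) (nbhs (a, b))) (nbhs (f a b)) cuv cab).
Qed.

(** An interior point has a punctured neighbourhood inside [[0, 1]], so the relative derivative
    there is the two-sided one required by the mean value theorem. *)
Lemma is_derive_within01 (f : R -> R) (d x : R) : 0 < x < 1 ->
  (fun t => (f t - f x) / (t - x)) @ within (@I01 R) x^' --> d ->
  is_derive x 1 f d.
Proof.
move=> x01 cf.
have cf' : (fun t => (f t - f x) / (t - x)) @ x^' --> d.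
  apply: cvg_trans cf; apply: cvg_app => A wA.
  have nI : \forall t \near x^', I01 t.
    apply: cvg_within; have := @near_in_itvoo R 0 1 x.
    rewrite in_itv /= => /(_ x01); apply: filterS => t.
    by rewrite /I01 /= in_itv /= => /andP[? ?]; rewrite !ltW.
  by apply: filterS2 nI wA => t It; apply.
have H : (fun k => k^-1 *: ((f \o shift x) (k *: 1) - f x)) @ 0^' --> d.
  move=> A /cf'.
  rewrite /= !nbhs_simpl /= => /nbhs_ballP[e /= e0 eA].
  apply/nbhs_ballP; exists e => //= k; rewrite /ball /= sub0r normrN => ke k0.
  have := eA (k + x); rewrite /ball /= opprD addrCA subrr addr0 normrN => /(_ ke).
  have kx : k + x != x by rewrite -subr_eq0 addrK.
  by move=> /(_ kx); rewrite addrK mulrC /= /GRing.scale /= mulr1.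
by split; [apply/cvg_ex; exists d | exact/cvg_lim].
Qed.

(** Retraction of the line onto [[0, 1]]; precomposition with it turns continuity on the square into
    continuity on the whole line. *)
Definition clamp01 (t : R) : R := Num.max 0 (Num.min 1 t).

Lemma clamp01_in (t : R) : I01 (clamp01 t).
Proof.
by rewrite /I01 /clamp01 /= le_max lexx /= ge_max ler01 ge_min lexx.
Qed.

Lemma clamp01_id (t : R) : I01 t -> clamp01 t = t.
Proof. by case/andP=> t0 t1; rewrite /clamp01 (min_idPr t1) (max_idPr t0). Qed.

Lemma continuous_clamp01 : continuous clamp01.
Proof.
move=> t; apply: (@continuous_max R R (fun=> 0) (fun s => Num.min 1 s)).
  exact: cvg_cst.
apply: (@continuous_min R R (fun=> 1) id); first exact: cvg_cst.
exact: cvg_id.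
Qed.

Lemma within_continuous_clamp01 (f g : R -> R) (a b : R) :
  (forall t, f t = g (clamp01 t)) -> continuous f -> 0 <= a -> b <= 1 ->
  {within `[a, b], continuous g}.
Proof.
move=> fg cf a0 b1; apply: (@subspace_eq_continuous _ _ _ f).
  move=> t; rewrite inE /= in_itv /= => /andP[at_ tb].
  by rewrite fg clamp01_id // /I01 /= (le_trans a0 at_) (le_trans tb b1).
exact: continuous_subspaceT.
Qed.

Lemma cont_on_square_comp (f : R -> R -> R) (u v : R -> R) :
  cont_on_square f -> continuous u -> continuous v ->
  (forall t, I01 (u t)) -> (forall t, I01 (v t)) ->
  continuous (fun t => f (u t) (v t)).
Proof.
move=> cf cu cv Iu Iv t.
by apply: cont_on_square_cvg => //; [exact: cu | exact: cv].
Qed.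

Lemma ex_antiderivative01 (w : R -> R) : continuous w ->
  exists v : R -> R, forall x, I01 x -> is_derive x 1 v (w x).
Proof.
move=> cw.
(* Integrating from -1, with 2 as right end in the fundamental theorem, makes 0 and 1 interior
   points, so [v] is differentiable there too. *)
exists (fun x => \int[lebesgue_measure]_(t in `[-1, x]) w t)%R.
move=> x /andP[x0 x1].
have [] := @continuous_FTC1 R w (BLeft (-1)) x 2.
- by lra.
- apply: (@continuous_compact_integrable R w); first exact: segment_compact.
  exact: continuous_subspaceT.
- by rewrite /= lte_fin; lra.
- exact: cw.
- move=> dv vE; have := derivableP dv; rewrite -derive1E vE; exact.
Qed.

End Calculus.

(** * The twist condition and the strict sub-action it yields *)

Section Twist.
Variables (R : realType) (h d1 d21 : R -> R -> R).
Hypotheses (h1 : is_partial1 h d1) (h21 : is_partial2 d1 d21).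
Hypotheses (ch : cont_on_square h) (cd1 : cont_on_square d1).
Hypothesis d21_lt0 : forall x y : R, I01 x -> I01 y -> d21 x y < 0.

Lemma d1_decreasing (c x y : R) : I01 c -> 0 <= x -> x < y -> y <= 1 ->
  d1 c y < d1 c x.
Proof.
move=> Ic x0 xy y1.
have [|//|t] := @MVT R (d1 c) (d21 c) x y xy.
- move=> t; rewrite in_itv /= => /andP[xt ty].
  apply: is_derive_within01; first by apply/andP; split; lra.
  by apply: h21 => //; apply/andP; split; lra.
- apply: (@within_continuous_clamp01 _ (fun t => d1 c (clamp01 t))) => //.
  apply: (@cont_on_square_comp _ d1 (fun=> c) (@clamp01 R)) => //.
  + by move=> ?; exact: cvg_cst.
  + exact: continuous_clamp01.
  + exact: clamp01_in.
- rewrite in_itv /= => /andP[xt ty] E.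
  rewrite -subr_lt0 E nmulr_rlt0 ?subr_gt0 //.
  by apply: d21_lt0 => //; apply/andP; split; lra.
Qed.

(** For fixed [y], the function [t |-> h t y - v t] has derivative [d1 t y - d1 t t], negative for
    [t < y] and positive for [t > y]; hence [y] is its strict minimiser. *)
Lemma ex_subaction : exists v : R -> R,
  [/\ forall x, I01 x -> {for x, continuous v} &
      forall x y, I01 x -> I01 y -> x != y -> v x - v y < h x y - h y y].
Proof.
have cw : continuous (fun t => d1 (clamp01 t) (clamp01 t)).
  apply: cont_on_square_comp => //;
    [exact: continuous_clamp01|exact: continuous_clamp01|exact: clamp01_in..].
have [v dv] := ex_antiderivative01 cw.
have cv x : I01 x -> {for x, continuous v}.
  move=> Ix; apply/differentiable_continuous/derivable1_diffP.
  by have [] := dv x Ix.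
exists v; split => // x y Ix Iy xy.
have key p q : 0 <= p -> p < q -> q <= 1 -> exists2 c, p < c < q &
    (h q y - v q) - (h p y - v p) = (d1 c y - d1 c c) * (q - p).
  move=> p0 pq q1.
  have [|//|c] :=
    @MVT R (fun t => h t y - v t) (fun c => d1 c y - d1 c c) p q pq.
  - move=> t; rewrite in_itv /= => /andP[pt tq].
    have It : I01 t by apply/andP; split; lra.
    apply: is_deriveB.
      apply: (@is_derive_within01 _ (h^~ y)); first by apply/andP; split; lra.
      exact: h1.
    by have := dv t It; rewrite clamp01_id.
  - apply: (@within_continuous_clamp01 _
      (fun t => h (clamp01 t) y - v (clamp01 t))) => //.
    move=> t; apply: cvgB.
      apply: (@cont_on_square_comp _ h (@clamp01 R) (fun=> y)) => //.
      + exact: continuous_clamp01.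
      + by move=> ?; exact: cvg_cst.
      + exact: clamp01_in.
    apply: (@continuous_comp _ _ _ (@clamp01 R) v).
      exact: continuous_clamp01.
    exact/cv/clamp01_in.
  - by rewrite in_itv /= => ? ?; exists c.
move: Ix Iy => /andP[x0 x1] /andP[y0 y1].
have [xy'|yx|/eqP] := ltgtP x y; last by rewrite (negPf xy).
  have [c /andP[xc cy] E] := key x y x0 xy' y1.
  suff : (d1 c y - d1 c c) * (y - x) < 0 by rewrite -E; lra.
  rewrite pmulr_llt0 ?subr_gt0 // subr_lt0.
  by apply: d1_decreasing; rewrite /I01 /=; lra.
have [c /andP[yc cx] E] := key y x y0 yx x1.
suff : (d1 c y - d1 c c) * (x - y) > 0 by rewrite -E; lra.
rewrite pmulr_lgt0 ?subr_gt0 //.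
by apply: d1_decreasing; rewrite /I01 /=; lra.
Qed.

Lemma ex_diagonal_min : exists2 a, I01 a & forall t, I01 t -> h a a <= h t t.
Proof.
have cd : {within `[0, 1], continuous (fun t => h t t)}.
  apply: (@within_continuous_clamp01 _ (fun t => h (clamp01 t) (clamp01 t))) => //.
  by apply: cont_on_square_comp => //;
    [exact: continuous_clamp01|exact: continuous_clamp01|exact: clamp01_in..].
have [a Ia amin] := EVT_min (@ler01 R) cd.
by exists a => [|t It]; [move: Ia; rewrite in_itv | apply: amin; rewrite in_itv].
Qed.

Lemma hstar_le (t : R) : I01 t -> hstar h <= h t t.
Proof.
move=> It; have [a Ia amin] := ex_diagonal_min.
apply: ge_inf; last by exists t.
by exists (h a a) => _ [s Is <-]; exact: amin.
Qed.

Lemma hstar_attained : exists2 a, I01 a & h a a = hstar h.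
Proof.
have [a Ia amin] := ex_diagonal_min.
exists a => //; apply/eqP; rewrite eq_le hstar_le // andbT.
apply: lb_le_inf; first by exists (h a a), a.
by move=> _ [t It <-]; exact: amin.
Qed.

End Twist.

(** * The shift space: metric, neighbourhoods, Borel measurability *)

Section ShiftSpace.
Variable R : realType.
Local Notation X := (Xseq R).
Local Notation sigma := (@Defs.shift R).
Implicit Types x y z : X.

Lemma iter_shiftE x n i : iter n sigma x i = x (n + i)%N.
Proof. by elim: n i => [//|n IH] i; rewrite iterS /= IH addnS. Qed.

Lemma Xseq_eq x y : (forall i, x i = y i) -> x = y.
Proof.
case: x y => [x Ix] [y Iy] /= /funext xy; subst y.
by congr MkX; exact: Prop_irrelevance.
Qed.

(** Domination by a geometric series of ratio 1/2. Since [dX] is a [limn], bounds on it can be drawn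
    from partial sums only once convergence is known. *)
Lemma is_cvg_dX x y : cvgn (series (fun i => `|x i - y i| / 2 ^+ i.+1)).
Proof.
apply: (@series_le_cvg _ _ (geometric 2^-1 2^-1)).
- by move=> n; rewrite divr_ge0 // exprn_ge0.
- by move=> n; rewrite /= mulr_ge0 ?exprn_ge0 ?invr_ge0.
- move=> n /=; rewrite exprVn -invfM -exprS ler_piMl ?invr_ge0 ?exprn_ge0 //.
  by have /andP[? ?] := xs_in01 x n; have /andP[? ?] := xs_in01 y n;
    rewrite ler_norml; apply/andP; split; lra.
- apply: is_cvg_geometric_series.
  by rewrite ger0_norm ?invr_ge0 // invf_lt1 // ltr1n.
Qed.

Lemma dX_ge_partial x y n :
  \sum_(0 <= i < n) (`|x i - y i| / 2 ^+ i.+1) <= dX x y.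
Proof.
apply: (nondecreasing_cvgn_le _ (@is_cvg_dX x y) n).
by apply: nondecreasing_series => i _ _; rewrite divr_ge0 // exprn_ge0.
Qed.

Lemma dX_coord x y i : `|x i - y i| <= 2 ^+ i.+1 * dX x y.
Proof.
have := dX_ge_partial x y i.+1; rewrite big_nat_recr //= => le_dX.
rewrite mulrC -ler_pdivrMr ?exprn_gt0 //; apply: le_trans le_dX.
by rewrite lerDr sumr_ge0 // => k _; rewrite divr_ge0 // exprn_ge0.
Qed.

Lemma dXxx x : dX x x = 0.
Proof.
rewrite /dX [X in limn X](_ : _ = fun=> 0) ?lim_cst //.
by apply/funext => n; rewrite big1 // => i _; rewrite subrr normr0 mul0r.
Qed.

Lemma dX_sym x y : dX x y = dX y x.
Proof.
by congr (limn _); apply/funext => n; apply: eq_bigr => i _; rewrite distrC.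
Qed.

(** Dropping coordinate 0 moves every other coordinate one place to the left, which doubles its
    weight. *)
Lemma dX_shift x y : dX (sigma x) (sigma y) <= 2 * dX x y.
Proof.
apply: limr_le; first exact: is_cvg_dX.
near=> n; have := dX_ge_partial x y n.+1.
rewrite big_nat_recl //= => le_dX.
rewrite -ler_pdivrMl //; apply: le_trans le_dX.
rewrite mulr_sumr ler_wpDl ?divr_ge0 ?exprn_ge0 //.
by apply: ler_sum => i _; rewrite [2 ^+ i.+2]exprS invfM mulrCA.
Unshelve. all: by end_near. Qed.

(** The neighbourhood filter of [dX]; continuity on [X] is expressed as convergence along it. *)
Definition nbhsX x : set_system X :=
  [set P | exists2 e : R, 0 < e & forall y, dX x y < e -> P y].

#[local] Instance nbhsX_filter x : Filter (nbhsX x).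
Proof.
split.
- by exists 1.
- move=> P Q [e e0 eP] [f f0 fQ].
  exists (Num.min e f); first by rewrite lt_min e0.
  by move=> y; rewrite lt_min => /andP[/eP ? /fQ].
- by move=> P Q PQ [e e0 eP]; exists e => // y /eP /PQ.
Qed.

Lemma coord_cvg x i : (fun z : X => z i) @ nbhsX x --> x i.
Proof.
apply/cvgrPdist_lt => e e0.
exists (e / 2 ^+ i.+1); first by rewrite divr_gt0 ?exprn_gt0.
move=> y xy; apply: le_lt_trans (dX_coord x y i) _.
by rewrite mulrC -ltr_pdivlMr ?exprn_gt0.
Qed.

Lemma shift_cvg x : sigma @ nbhsX x --> nbhsX (sigma x).
Proof.
move=> P [e e0 eP]; exists (e / 2); first by rewrite divr_gt0.
move=> y xy; apply: eP; apply: le_lt_trans (dX_shift x y) _.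
by rewrite mulrC -ltr_pdivlMr.
Qed.

Lemma iter_shift_cvg x n : iter n sigma @ nbhsX x --> nbhsX (iter n sigma x).
Proof.
elim: n => [|n IH]; first exact: cvg_id.
exact: (cvg_comp (iter n sigma) sigma IH (@shift_cvg _)).
Qed.

Lemma measurable_shift : measurable_fun [set: XB R] (sigma : XB R -> XB R).
Proof.
apply: (@measurability _ _ (XB R) (XB R) setT sigma (@openX R)) => //.
move=> _ [A oA <-]; rewrite setTI; apply: sub_sigma_algebra => x Ax.
by have [e e0 eA] := oA _ Ax; apply: shift_cvg; exists e.
Qed.

Lemma nbhsX_continuous_measurable (f : X -> R) :
  (forall x, f @ nbhsX x --> f x) -> measurable_fun [set: XB R] (f : XB R -> R).
Proof.
move=> cf.
apply: (@measurability _ _ (XB R) _ setT f _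
  (measurable_realfun.RGenOpens.measurableE R)).
move=> _ [_ [a [b ->]] <-]; rewrite setTI; apply: sub_sigma_algebra => x fx.
apply: (cf x); exact: near_in_itvoo.
Qed.

End ShiftSpace.

(** * The minimal mean over invariant measures *)

Section Alpha.
Variable R : realType.
Local Notation X := (Xseq R).
Local Notation sigma := (@Defs.shift R).
#[local] Existing Instance nbhsX_filter.

Lemma nbhsX_bounded_integrable (mu : probability (XB R) R) (f : X -> R) (M : R) :
  (forall x, f @ nbhsX x --> f x) -> (forall x, `|f x| <= M) ->
  mu.-integrable [set: XB R] (EFin \o f).
Proof.
move=> cf fM; apply: measurable_bounded_integrable => //.
- exact: le_lt_trans (probability_le1 mu measurableT) (ltry 1).
- exact: nbhsX_continuous_measurable.
- exists M; split; first exact: num_real.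
  by move=> N MN x _ /=; apply: le_trans (fM x) (ltW MN).
Qed.

(** Change of variables along the shift: invariance says that the pushforward of [mu] is [mu]. *)
Lemma integral_invariant (mu : probability (XB R) R) (f : X -> R) (M : R) :
  invariant_prob mu ->
  (forall x, f @ nbhsX x --> f x) -> (forall x, `|f x| <= M) ->
  (\int[mu]_x (f (sigma x))%:E = \int[mu]_x (f x)%:E)%E.
Proof.
move=> inv cf fM; have ms := @measurable_shift R.
have mf := nbhsX_continuous_measurable cf.
have csf x : (f \o sigma) @ nbhsX x --> f (sigma x).
  exact: (cvg_comp sigma f (@shift_cvg R x) (cf _)).
have := @integral_pushforward _ _ _ _ _ _ ms mu setT (EFin \o f) _ _ measurableT.
rewrite preimage_setT => <-.
- by apply: (@eq_measure_integral _ _ _ _ mu) => A mA _; exact: inv.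
- exact/measurable_realfun.measurable_EFinP.
- by apply: (@nbhsX_bounded_integrable mu (f \o sigma) M) => // x; exact: fM.
Qed.

Lemma continuous01_bounded (v : R -> R) :
  (forall x, I01 x -> {for x, continuous v}) ->
  exists M, forall x, I01 x -> `|v x| <= M.
Proof.
move=> cv.
have cv' : {within `[0, 1], continuous v}.
  apply/subspace_continuousP => x; rewrite -I01E => Ix.
  exact: cvg_trans (cvg_app _ (cvg_within _)) (cv x Ix).
have [M [_ HM]] :=
  compact_bounded (continuous_compact cv' (@segment_compact R 0 1)).
(* [compact_bounded] gives bounds strictly above [M] only, hence [M + 1]. *)
exists (M + 1) => x Ix; apply: (HM (M + 1)); first by rewrite ltrDl.
by exists x => //=; rewrite in_itv.
Qed.

Lemma cont_on_square_bounded (h : R -> R -> R) : cont_on_square h ->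
  exists M, forall x y, I01 x -> I01 y -> `|h x y| <= M.
Proof.
move=> ch; have cS : compact (@Sq01 R).
  by rewrite Sq01E I01E; apply: compact_setX; exact: segment_compact.
have [M [_ HM]] := compact_bounded (continuous_compact ch cS).
exists (M + 1) => x y Ix Iy; apply: (HM (M + 1)); first by rewrite ltrDl.
by exists (x, y).
Qed.

Lemma phi_of_cvg (h : R -> R -> R) (x : X) : cont_on_square h ->
  phi_of h @ nbhsX x --> phi_of h x.
Proof.
move=> ch.
apply: (@cont_on_square_cvg R h X _ _ (fun z : X => z 0%N) (fun z : X => z 1%N)).
- exact: ch.
- exact: xs_in01.
- exact: xs_in01.
- by move=> z; exact: xs_in01.
- by move=> z; exact: xs_in01.
- exact: coord_cvg.
- exact: coord_cvg.
Qed.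

Section Subaction.
Variables (h : R -> R -> R) (v : R -> R).
Hypothesis ch : cont_on_square h.
Hypothesis cv : forall x, I01 x -> {for x, continuous v}.
Hypothesis vh : forall x y, I01 x -> I01 y -> x != y ->
  v x - v y < h x y - h y y.

Lemma subaction_coord_cvg (x : X) i :
  (fun z : X => v (z i)) @ nbhsX x --> v (x i).
Proof.
apply: (cvg_comp (fun z : X => z i) v); first exact: coord_cvg.
exact/cv/xs_in01.
Qed.

(** The sub-action inequality combined with minimality of [hstar] on the diagonal; when the two
    coordinates agree, minimality alone gives the bound. *)
Lemma phi_of_ge (x : X) : hstar h + v (x 0%N) - v (x 1%N) <= phi_of h x.
Proof.
have I0 := xs_in01 x 0; have I1 := xs_in01 x 1.
have hI := hstar_le ch I1; rewrite /phi_of.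
have [->|/(vh I0 I1)] := eqVneq (x 0%N) (x 1%N); first by rewrite addrK.
by lra.
Qed.

(** Integrate [phi_of_ge]: the coboundary [v (x 0) - v (x 1)] has integral zero by invariance. *)
Lemma integral_phi_ge (mu : probability (XB R) R) : invariant_prob mu ->
  ((hstar h)%:E <= \int[mu]_x (phi_of h x)%:E)%E.
Proof.
move=> inv.
have [M vM] := continuous01_bounded cv; have [N hN] := cont_on_square_bounded ch.
have c0 x := @subaction_coord_cvg x 0%N; have c1 x := @subaction_coord_cvg x 1%N.
have vi i (x : X) : `|v (x i)| <= M by exact/vM/xs_in01.
have i0 := nbhsX_bounded_integrable mu c0 (vi 0%N).
have i1 := nbhsX_bounded_integrable mu c1 (vi 1%N).
have ic : mu.-integrable setT (EFin \o (fun=> hstar h)).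
  by apply: (@nbhsX_bounded_integrable mu _ `|hstar h|) => // x; exact: cvg_cst.
have iphi : mu.-integrable setT (EFin \o phi_of h).
  apply: (@nbhsX_bounded_integrable mu _ N) => [x|x]; first exact: phi_of_cvg.
  by apply: hN; exact: xs_in01.
have E : (\int[mu]_x (v (x 1%N))%:E = \int[mu]_x (v (x 0%N))%:E)%E.
  exact: (@integral_invariant mu (fun x : X => v (x 0%N)) M inv c0 (vi 0%N)).
have F : (\int[mu]_x ((hstar h)%:E + (v (x 0%N))%:E - (v (x 1%N))%:E) =
    (hstar h)%:E)%E.
  rewrite integralB //=; last exact: integrableD.
  rewrite integralD //= integral_cst //= probability_setT mule1 E addeK //.
  by apply: integral_fune_fin_num.
rewrite -F; apply: le_integral => //=.
  exact: (integrableB measurableT (integrableD measurableT ic i0) i1).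
by move=> x _; rewrite lee_fin; exact: phi_of_ge.
Qed.

Lemma const_in01 (a : R) (Ia : I01 a) (i : nat) : 0 <= (fun=> a) i <= 1.
Proof. exact: Ia. Qed.

Lemma alphaE : alpha (phi_of h) = hstar h.
Proof.
have [a Ia ha] := hstar_attained ch.
rewrite /alpha; suff -> : ereal_inf [set (\int[mu]_x (phi_of h x)%:E)%E
  | mu in @invariant_prob R] = (hstar h)%:E by [].
apply/eqP; rewrite eq_le; apply/andP; split; last first.
  by apply/ereal_infP => _ [mu inv <-]; exact: integral_phi_ge.
(* The value is attained by the Dirac mass at the constant sequence of a diagonal minimiser,
   invariant because this point is fixed by the shift. *)
apply: ereal_inf_lbound; exists (\d_(MkX (const_in01 Ia) : XB R)).
  move=> A mA; rewrite /= !diracE; congr (_%:R%:E); congr nat_of_bool.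
  have fixa : sigma (MkX (const_in01 Ia)) = MkX (const_in01 Ia).
    exact: Xseq_eq.
  rewrite -[in RHS]fixa.
  by apply/idP/idP; rewrite !inE.
rewrite integral_dirac //; last first.
  apply/measurable_realfun.measurable_EFinP.
  by apply: (@nbhsX_continuous_measurable R (phi_of h)) => x; exact: phi_of_cvg.
by rewrite diracT mul1e /phi_of /= ha.
Qed.

End Subaction.
End Alpha.

(** * Costs of orbit segments and the Mañé potential along an orbit *)

Section Mane.
Variables (R : realType) (h : R -> R -> R) (v : R -> R).
Local Notation X := (Xseq R).
Local Notation sigma := (@Defs.shift R).
Local Notation bsum := (bsum (phi_of h)).
Implicit Types x y z : X.
#[local] Existing Instance nbhsX_filter.
Hypothesis ch : cont_on_square h.
Hypothesis cv : forall x : R, I01 x -> {for x, continuous v}.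
Hypothesis vh : forall x y : R, I01 x -> I01 y -> x != y ->
  v x - v y < h x y - h y y.

Lemma bsumE z m n : bsum z m n = \sum_(m <= i < n) (h (z i) (z i.+1) - hstar h).
Proof.
apply: eq_bigr => i _; rewrite (alphaE ch cv vh) /phi_of !iter_shiftE.
by rewrite addn0 addn1.
Qed.

Lemma bsum_ge z m n : (m <= n)%N -> v (z m) - v (z n) <= bsum z m n.
Proof.
move=> mn; rewrite -opprB -(telescope_sumr (fun k => v (z k)) mn) -sumrN bsumE.
apply: ler_sum => i _; have := phi_of_ge ch vh (iter i sigma z).
by rewrite /phi_of !iter_shiftE addn0 addn1; lra.
Qed.

(** Over a closed segment [v] telescopes away, so the nonnegative excesses [F i] sum to 0 and all
    vanish. Strictness of [vh] then forces equal neighbours, and [F k = 0] gives the value of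
    [h]. *)
Lemma bsum_cycle_eq0 z m n : z m = z n -> bsum z m n = 0 ->
  forall k, (m <= k < n)%N -> z k = z k.+1 /\ h (z k.+1) (z k.+1) = hstar h.
Proof.
move=> zmn S0 k /andP[mk kn].
have mn : (m <= n)%N by rewrite ltnW // (leq_ltn_trans mk).
pose F i := h (z i) (z i.+1) - hstar h - (v (z i) - v (z i.+1)).
have F0 i : 0 <= F i.
  have := phi_of_ge ch vh (iter i sigma z).
  by rewrite /phi_of /F !iter_shiftE addn0 addn1; lra.
have : \sum_(m <= i < n) F i == 0.
  rewrite sumrB -bsumE S0 sub0r -sumrN.
  under eq_bigr do rewrite opprB.
  by rewrite (telescope_sumr (fun k => v (z k)) mn) zmn subrr.
rewrite psumr_eq0 // => /allP/(_ k).
rewrite mem_index_iota mk kn => /(_ isT) /= /eqP.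
have I0 := xs_in01 z k; have I1 := xs_in01 z k.+1.
have hI := hstar_le ch I1; rewrite /F.
have [->|/(vh I0 I1)] := eqVneq (z k) (z k.+1); last by lra.
by move=> E; split=> //; lra.
Qed.

Lemma bsum_cvg x n : (fun z => bsum z 0 n) @ nbhsX x --> bsum x 0 n.
Proof.
elim: n => [|n IH].
  rewrite /Defs.bsum big_geq //; under eq_cvg do rewrite big_geq //.
  exact: cvg_cst.
rewrite /Defs.bsum big_nat_recr //=; under eq_cvg do rewrite big_nat_recr //=.
apply: cvgD; first exact: IH.
apply: cvgB; last exact: cvg_cst.
apply: (cvg_comp (iter n sigma) (phi_of h) (@iter_shift_cvg R x n)).
exact: phi_of_cvg.
Qed.

(* After time [j] the orbit segment of [z] is almost a loop at [x j], whose
   cost is bounded below by telescoping [v]. *)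
Lemma bsum_ge_long x j (d : R) : 0 < d -> exists2 e : R, 0 < e &
  forall n z, (j <= n)%N -> Bset x (iter j sigma x) n e z ->
    bsum x 0 j - d <= bsum z 0 n.
Proof.
move=> d0; have d3 : 0 < d / 3 by rewrite divr_gt0.
have /cvgrPdist_lt/(_ _ d3)[e1 e10 H1] := @bsum_cvg x j.
have /cvgrPdist_lt/(_ _ d3)[e2 e20 H2] := @subaction_coord_cvg _ v cv x j.
have /cvgrPdist_lt/(_ _ d3)[e3 e30 H3] :=
  @subaction_coord_cvg _ v cv (iter j sigma x) 0%N.
exists (Num.min e1 (Num.min e2 e3)); first by rewrite !lt_min e10 e20.
move=> n z jn []; rewrite !lt_min => /and3P[/H1 l1 /H2 l2 _].
rewrite dX_sym => /and3P[_ _ /H3]; rewrite !iter_shiftE !addn0 => l3.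
have := bsum_ge z jn.
rewrite [bsum z 0 n]/Defs.bsum (big_cat_nat _ jn) //=.
move: l1 l2 l3; rewrite /Defs.bsum !ltr_norml => /andP[? ?] /andP[? ?] /andP[? ?].
by lra.
Qed.

(** If [x] reaches the target at time [n], continuity of the sum of length [n] suffices; otherwise
    [Bset] is empty for small [e]. *)
Lemma bsum_ge_short x j n (d : R) : 0 < d ->
  (iter n sigma x = iter j sigma x -> bsum x 0 n = bsum x 0 j) ->
  exists2 e : R, 0 < e & forall z, Bset x (iter j sigma x) n e z ->
    bsum x 0 j - d <= bsum z 0 n.
Proof.
move=> d0 Hn; have [E|nE] := pselect (iter n sigma x = iter j sigma x).
  have /cvgrPdist_lt/(_ _ d0)[e e0 He] := @bsum_cvg x n.
  exists e => // z [/He + _]; rewrite (Hn E) ltr_norml => /andP[? ?]; lra.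
have [i xi] : exists i, x (n + i)%N != x (j + i)%N.
  apply: contrapT => /forallNP H; apply: nE; apply: Xseq_eq => i.
  by rewrite !iter_shiftE; apply/eqP/negPn/negP; exact: H.
(* The two coordinates are [2r] apart, while [z (n + i)] would have to lie within less than [r] of
   both. *)
pose r := `|x (n + i)%N - x (j + i)%N| / 2.
have r0 : 0 < r by rewrite divr_gt0 // normr_gt0 subr_eq0.
have /cvgrPdist_lt/(_ _ r0)[e1 e10 H1] := @coord_cvg R x (n + i).
have /cvgrPdist_lt/(_ _ r0)[e2 e20 H2] := @coord_cvg R (iter j sigma x) i.
exists (Num.min e1 e2); first by rewrite lt_min e10.
move=> z []; rewrite !lt_min => /andP[/H1 l1 _].
rewrite dX_sym => /andP[_ /H2]; rewrite !iter_shiftE => l2.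
have := ler_distD (z (n + i)%N) (x (n + i)%N) (x (j + i)%N).
by move: l1 l2; rewrite /r [`|z _ - _|]distrC; lra.
Qed.

(** Taking [x] itself with [n = j] bounds every infimum from above; the long and short estimates
    bound it from below up to [d]. The hypothesis on [n < j] covers early visits to the target. *)
Lemma mane_pot_orbit x j : (0 < j)%N ->
  (forall n, (n < j)%N -> iter n sigma x = iter j sigma x ->
     bsum x 0 n = bsum x 0 j) ->
  mane_pot (phi_of h) x (iter j sigma x) = (bsum x 0 j)%:E.
Proof.
move=> j0 Hj.
have main (d : R) : 0 < d -> exists2 e : R, 0 < e &
    forall n z, Bset x (iter j sigma x) n e z -> bsum x 0 j - d <= bsum z 0 n.
  move=> d0; have [e e0 He] := bsum_ge_long x j d0.
  (* Only finitely many lengths lie below [j], so induction on [k] produces a common radius as a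
     minimum. *)
  have short k : (k <= j)%N -> exists2 f : R, 0 < f & forall n z, (n < k)%N ->
      Bset x (iter j sigma x) n f z -> bsum x 0 j - d <= bsum z 0 n.
    elim: k => [|k IH] kj; first by exists 1.
    have [f f0 Hf] := IH (ltnW kj).
    have [g g0 Hg] := bsum_ge_short d0 (Hj k kj).
    exists (Num.min f g); first by rewrite lt_min f0.
    move=> n z; rewrite ltnS leq_eqVlt => /orP[/eqP ->|nk] [].
      rewrite !lt_min => /andP[_ ?] /andP[_ ?]; exact: Hg (conj _ _).
    rewrite !lt_min => /andP[? _] /andP[? _]; exact: Hf nk (conj _ _).
  have [f f0 Hf] := short j (leqnn j).
  exists (Num.min e f); first by rewrite lt_min e0.
  move=> n z []; rewrite !lt_min => /andP[xe xf] /andP[ye yf].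
  by have [jn|nj] := leqP j n; [exact: He | exact: Hf].
apply: cvg_lim => //; apply/fine_cvgP.
have up (e : R) : 0 < e ->
    (mane_inf (phi_of h) x (iter j sigma x) e <= (bsum x 0 j)%:E)%E.
  move=> e0; apply: ereal_inf_lbound; exists j, x; split=> //; split=> //.
  by split; rewrite dXxx.
have lo (d : R) : 0 < d -> \forall e \near (0 : R)^'+,
    ((bsum x 0 j - d)%:E <= mane_inf (phi_of h) x (iter j sigma x) e)%E.
  move=> /main[e e0 He]; near=> f; apply/ereal_infP => _ [n [z [_ [[xz yz] ->]]]].
  rewrite lee_fin; apply: He; have fe : f < e by near: f; exact: nbhs_right_lt.
  by split; [exact: lt_trans xz fe | exact: lt_trans yz fe].
(* Finiteness near 0 reduces the extended-real limit to a real one through [fine]. *)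
have fin : \forall e \near (0 : R)^'+,
    mane_inf (phi_of h) x (iter j sigma x) e \is a fin_num.
  near=> e; have e0 : 0 < e by [].
  rewrite fin_numE; apply/andP; split.
    rewrite gt_eqF //; apply: lt_le_trans (ltNyr _) _.
    by near: e; exact: (lo 1).
  by rewrite lt_eqF //; apply: le_lt_trans (up e e0) (ltry _).
split=> //; apply/cvgrPdist_le => d d0; near=> e.
have e0 : 0 < e by [].
have E : ((fine (mane_inf (phi_of h) x (iter j sigma x) e))%:E =
   mane_inf (phi_of h) x (iter j sigma x) e)%E by rewrite fineK //; near: e.
have := up e e0; rewrite -E lee_fin => upe.
have : ((bsum x 0 j - d)%:E <= mane_inf (phi_of h) x (iter j sigma x) e)%E.
  by near: e; exact: lo.
rewrite -E lee_fin /= => loe.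
by rewrite ler_norml; apply/andP; split; lra.
Unshelve. all: by end_near. Qed.

(** * Semi-static orbits: a sufficient criterion and the two classes *)

Lemma bsum_shift x k m n : bsum (iter k sigma x) m n = bsum x (k + m) (k + n).
Proof.
rewrite !bsumE [in RHS]addnC big_addn addKn; apply: eq_bigr => i _.
by rewrite !iter_shiftE addnS [(k + i)%N]addnC.
Qed.

(** Apply [mane_pot_orbit] at the [i]-th iterate: an early visit to the target leaves a closed
    segment up to the final time, and its zero cost makes the two sums equal. *)
Lemma semi_static_criterion x :
  (forall n j, (n < j)%N -> iter n sigma x = iter j sigma x ->
     bsum x n j = 0) -> semi_static (phi_of h) x.
Proof.
move=> Hx i j ij; rewrite -(subnKC (ltnW ij)) [(i + (j - i))%N]addnC iterD.
rewrite mane_pot_orbit ?subn_gt0 //.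
  by rewrite bsum_shift addn0 [(i + _)%N]addnC.
move=> n nj; rewrite -!iterD !bsum_shift addn0 => E.
have Z : bsum x (n + i) (j - i + i) = 0 by apply: Hx => //; lia.
rewrite [RHS]/Defs.bsum (@big_cat_nat _ _ _ (i + n)%N i (i + (j - i))%N) /=; try lia.
rewrite -[LHS]addr0; congr (_ + _).
by rewrite [(i + n)%N]addnC [(i + (j - i))%N]addnC -[LHS]Z.
Qed.

Lemma aperiodic_semi_static x : aperiodic_pts x -> semi_static (phi_of h) x.
Proof.
move=> Ax; apply: semi_static_criterion => n j nj E.
by have := Ax n j; rewrite E eqxx ltn_eqF // => /(_ isT).
Qed.

Lemma preimages_fixed_semi_static x :
  preimages_fixed h x -> semi_static (phi_of h) x.
Proof.
move=> [M [a [[Ia ha] xa]]]; apply: semi_static_criterion => n j nj E.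
have per i : x (n + i)%N = x (j + i)%N.
  by rewrite -!iter_shiftE E.
have xn i k : x (n + i)%N = x (n + i + k * (j - n))%N.
  elim: k => [|k ->]; first by rewrite addn0.
  rewrite -addnA per; congr (xs x _); rewrite mulSn; lia.
(* From time [n] on, [x] has period [j - n >= 1]; moving [M] periods ahead lands in the constant
   tail, so [x] already equals [a] from [n] on. *)
have tail i : x (n + i)%N = a.
  rewrite (xn i M) -(xa (n + i + M * (j - n) - M)%N) iter_shiftE; congr (xs x _).
  by rewrite subnKC //; nia.
rewrite bsumE big_nat big1 // => i /andP[ni ij].
by rewrite -(subnKC ni) -addnS !tail ha subrr.
Qed.

Lemma semi_static_cases x :
  semi_static (phi_of h) x -> aperiodic_pts x \/ preimages_fixed h x.
Proof.
move=> ssx; have [|nA] := pselect (aperiodic_pts x); first by left.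
right; have [i [j [ij E]]] :
    exists i j, (i < j)%N /\ iter i sigma x = iter j sigma x.
  apply: contrapT => H; apply: nA => i j ij; apply/negP => /eqP E; apply: H.
  by move: ij; rewrite neq_ltn => /orP[ij|ji]; [exists i, j | exists j, i].
pose p := (j - i)%N; have p0 : (0 < p)%N by rewrite subn_gt0.
have per L : iter (i + L * p) sigma x = iter i sigma x.
  elim: L => [|L IH]; first by rewrite addn0.
  rewrite mulSn addnCA iterD IH -iterD /p subnK; [by []|exact: ltnW].
(* Both segments join the same two points, so semi-staticity gives each of them the potential of
   that pair as its cost. *)
have B L1 L2 : (L1 < L2)%N ->
    bsum x (i + L1 * p) (i + L2 * p) = bsum x i (i + 1 * p).
  move=> LL; apply: EFin_inj; rewrite ssx ?ltn_add2l ?ltn_pmul2r //.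
  by rewrite ssx ?mul1n ?ltn_add2l; [rewrite !per -[in RHS](mul1n p) per | lia].
(* Two periods cost as much as one, but also twice as much. *)
have B0 : bsum x i (i + 1 * p) = 0.
  have := B 1%N 2%N isT; have := B 0%N 2%N isT.
  rewrite mul0n addn0 /Defs.bsum (@big_cat_nat _ _ _ (i + 1 * p)%N) /=; try lia.
  by rewrite !/Defs.bsum => + E2; rewrite E2; lra.
(* A closed segment of [k.+1] periods has cost 0 and contains the index [i + k], because
   [p >= 1]. *)
have loop k : x (i + k)%N = x (i + k.+1)%N /\
    h (x (i + k.+1)%N) (x (i + k.+1)%N) = hstar h.
  rewrite addnS; apply: (@bsum_cycle_eq0 x i (i + k.+1 * p)).
  - have := per k.+1 => /(congr1 (fun y : X => y 0%N)).
    by rewrite !iter_shiftE !addn0.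
  - by have := B 0%N k.+1 isT; rewrite mul0n addn0 B0.
  - by apply/andP; split; nia.
have xc k : x (i + k)%N = x i.
  by elim: k => [|k IH]; [rewrite addn0 | rewrite -(loop k).1].
exists i, (x i); split; last by move=> k; rewrite iter_shiftE xc.
by split; [exact: xs_in01 | rewrite -(loop 0%N).2 xc].
Qed.

(** [mane_set] collects forward iterates of semi-static points, so each of the two classes has to be
    forward invariant. *)
Lemma aperiodic_shift x k : aperiodic_pts x -> aperiodic_pts (iter k sigma x).
Proof.
move=> Ax i j ij; rewrite -!iterD; apply: Ax.
by rewrite eqn_add2r.
Qed.

Lemma preimages_fixed_shift x k :
  preimages_fixed h x -> preimages_fixed h (iter k sigma x).
Proof.
move=> [M [a [ma xa]]]; exists M, a; split=> // i.
by rewrite -[RHS](xa (k + i)%N) !iter_shiftE addnCA.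
Qed.

End Mane.

Theorem theorem3 (R : realType) (h d1 d2 d11 d21 d12 d22 : R -> R -> R) :
  is_C2_square h d1 d2 d11 d21 d12 d22 ->
  (forall x y : R, I01 x -> I01 y -> d21 x y < 0) ->
  mane_set (phi_of h) = @aperiodic_pts R `|` preimages_fixed h.
Proof.
move=> [h1 [_ [_ [h21 [_ [_ [ch [cd1 _]]]]]]]] d21_lt0.
have [v [cv vh]] := ex_subaction h1 h21 ch cd1 d21_lt0.
apply/seteqP; split=> [_ [k [x [ssx ->]]]|x Hx].
  have [Ax|Px] := semi_static_cases ch cv vh ssx.
    by left; exact: aperiodic_shift.
  by right; exact: preimages_fixed_shift.
(* Points of either class are themselves semi-static, so the iterate of order 0 serves. *)
exists 0%N, x; split=> //.
by case: Hx => Hx; [exact: (aperiodic_semi_static ch cv vh) |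
  exact: (preimages_fixed_semi_static ch cv vh)].
Qed.
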